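(* Let $S=(E,\mathcal{A},\rho,\tau)$ be a dynamical system, let $\theta\in\mathbb{R}$ be irrational, and let $f\colon E\to[0,1]$ be a measurable function such that $f(1-f)\in\mathcal{C}_2(S)$ and such that $f$ is not ($\rho$-almost everywhere equal to) an indicator function, i.e. a function with values in $\{0,1\}$. For $x\in E$ let $(R_j)_{j\ge1}$ be independent random rotations of $\mathbb{R}^2$, i.e. random elements of $SO(2)\cong U(1)=\{z\in\mathbb{C}:|z|=1\}$, with $$P(R_j=e^{2\pi i\theta})=f(\tau^jx),\qquad P(R_j=e^{-2\pi i\theta})=1-f(\tau^jx).$$ Then, for $\rho$-almost every $x\in E$, the product $R_1R_2\cdots R_n$ converges in law, as $n\to\infty$, to the normalized Haar measure on $SO(2)$.
   Context: A dynamical system $S=(E,\mathcal{A},\rho,\tau)$ consists of a probability space $(E,\mathcal{A},\rho)$ and a (measurable) transformation $\tau\colon E\to E$. The class $\mathcal{C}_2(S)$ is the set of functions $g\in L^1(E,\rho)$ such that $$\sup_{x\in E}\Big|\sum_{i=1}^n\Big(g(\tau^ix)-\int_E g\,d\rho\Big)\Big|=o(\sqrt n)\quad\text{as }n\to\infty.$$ *)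

(* Defs.v *)
From HB Require Import structures.
From mathcomp Require Import all_boot all_order all_algebra.
From mathcomp Require Import finmap complex.
From mathcomp Require Import all_classical all_reals all_analysis.
From mathcomp Require Import measurable_realfun.
From mathcomp Require Import ring lra.

Set Implicit Arguments.
Unset Strict Implicit.
Unset Printing Implicit Defensive.

Import Order.TTheory GRing.Theory Num.Theory.
Import numFieldNormedType.Exports.

Local Open Scope classical_set_scope.
Local Open Scope ring_scope.
Local Open Scope complex_scope.

Section circle.
Variable R : realType.

(* SO(2), as the group of complex numbers of modulus 1, with the topology
   induced by C and its Borel sigma-algebra. *)
Record circle := Circle { circle_val : R[i]; _ : `|circle_val| == 1 }.

HB.instance Definition _ := [isSub of circle for circle_val].
HB.instance Definition _ := [Choice of circle by <:].

Implicit Types u v w : circle.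

Lemma circle_norm u : `|val u| = 1.
Proof. by apply/eqP; case: u. Qed.

Let one_circle : `|1 : R[i]| == 1. Proof. by rewrite normr1. Qed.
Let mul_circle u v : `|val u * val v| == 1.
Proof. by rewrite normrM !circle_norm mulr1. Qed.
Let inv_circle u : `|(val u)^-1| == 1.
Proof. by rewrite normfV circle_norm invr1. Qed.

Definition circle1 := Circle one_circle.
Definition circleM u v := Circle (mul_circle u v).
Definition circleV u := Circle (inv_circle u).

Let circle_neq0 u : val u != 0.
Proof. by rewrite -normr_eq0 circle_norm oner_neq0. Qed.

Let circleMA : associative circleM.
Proof. by move=> u v w; apply/val_inj; rewrite /= mulrA. Qed.
Let circle1M : left_id circle1 circleM.
Proof. by move=> u; apply/val_inj; rewrite /= mul1r. Qed.
Let circleM1 : right_id circle1 circleM.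
Proof. by move=> u; apply/val_inj; rewrite /= mulr1. Qed.
Let circleVM : left_inverse circle1 circleV circleM.
Proof. by move=> u; apply/val_inj; rewrite /= mulVf ?circle_neq0. Qed.
Let circleMV : right_inverse circle1 circleV circleM.
Proof. by move=> u; apply/val_inj; rewrite /= mulfV ?circle_neq0. Qed.

HB.instance Definition _ :=
  isGroup.Build circle circleMA circle1M circleM1 circleVM circleMV.

HB.instance Definition _ := isPointed.Build circle circle1.
HB.instance Definition _ := Topological.copy circle
  (initial_topology (circle_val : circle -> R[i]^o)).
HB.instance Definition _ := Measurable.copy circle
  (g_sigma_algebraType (@open circle)).

Lemma circle_cis (t : R) : `|cos t +i* sin t| == 1.
Proof. by rewrite normc_def /= cos2Dsin2 sqrtr1. Qed.

(* [cis t] is e^(it) *)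
Definition cis (t : R) := Circle (circle_cis t).

(* [mu] is normalized since it is a probability. *)
Definition is_haar (mu : probability circle R) : Prop :=
  forall (u : circle) (A : set circle), measurable A ->
    mu [set (u * z)%g | z in A] = mu A.

Definition converges_in_law d (Omega : measurableType d)
    (P : probability Omega R) (X : nat -> Omega -> circle)
    (mu : probability circle R) : Prop :=
  forall h : circle -> R, continuous h -> bounded_fun h ->
    (\int[P]_w (h (X n w))%:E)%E @[n --> \oo] --> (\int[mu]_z (h z)%:E)%E.

End circle.

Section haar_existence.
Variable R : realType.

Lemma continuous_real_complex : continuous (fun t : R => t%:C : R[i]^o).
Proof.
move=> t; apply/cvgrPdist_lt => e e0.
have eE : e = (complex.Re e)%:C.
  apply/esym/eqP; rewrite eq_complex /= eqxx /= eq_sym.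
  by move: e0; rewrite ltcE /= => /andP[/eqP -> _].
have e0' : 0 < complex.Re e by move: e0; rewrite ltcE => /andP[].
near=> s.
rewrite -[_ - _](rmorphB (real_complex R)) /= normc_def /= expr0n /= addr0 sqrtr_sqr eE ltcR.
near: s.
by move/cvgrPdist_lt : (@cvg_id _ (nbhs t)); apply.
Unshelve. all: by end_near. Qed.

Lemma continuous_cis : continuous (@cis R).
Proof.
apply: (@continuous_comp_initial (circle R) R (R[i]^o) (@circle_val R)).
have -> : (@circle_val R \o @cis R) =
   (fun t => (cos t)%:C + 'i%C * (sin t)%:C : R[i]^o).
  by apply/funext => t /=; apply/eqP; rewrite eq_complex /=; apply/andP; split; apply/eqP; ring.
move=> t; apply: (@cvgD _ (R[i]^o)).
  apply: (@continuous_comp _ _ (R[i]^o) (@cos R) (fun t => t%:C)).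
    exact: continuous_cos.
  exact: continuous_real_complex.
apply: (@cvgM R[i]); first exact: cvg_cst.
apply: (@continuous_comp _ _ (R[i]^o) (@sin R) (fun t => t%:C)).
  exact: continuous_sin.
exact: continuous_real_complex.
Qed.

Definition turn (t : R) := cis (2 * pi * t).

Lemma continuous_turn : continuous turn.
Proof.
move=> t; apply: (@continuous_comp _ _ _ (fun t => 2 * pi * t) (@cis R)).
  by apply: cvgM; [exact: cvg_cst|exact: cvg_id].
exact: continuous_cis.
Qed.

Lemma measurable_turn : measurable_fun setT turn.
Proof.
apply: (@measurability _ _ _ (circle R) _ _ (@open (circle R))) => //.
move=> _ [B oB <-]; rewrite setTI; apply: open_measurable.
by apply: open_comp => // x _; exact: continuous_turn.
Qed.

Lemma cisD (s t : R) : cis (s + t) = (cis s * cis t)%g.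
Proof.
apply/val_inj/eqP; rewrite eq_complex /= cosD sinD.
by apply/andP; split; apply/eqP => //; rewrite addrC.
Qed.

Lemma turnD1 t : turn (t + 1) = turn t.
Proof.
rewrite /turn mulrDr mulr1 mulr_natl.
by apply/val_inj/eqP; rewrite eq_complex /= cosD2pi sinD2pi !eqxx.
Qed.

Lemma turn_surj (u : circle R) : exists2 s, 0 <= s < 1 & u = turn s.
Proof.
have p0 := @pi_gt0 R.
have pp : 0 < 2 * pi :> R by rewrite mulr_gt0.
suff [a /andP[a0 a1] ->] : exists2 a, 0 <= a < 2 * pi & u = cis a.
  exists (a / (2 * pi)); last by rewrite /turn mulrC divfK// gt_eqF.
  by rewrite divr_ge0 ?(ltW pp)//= ltr_pdivrMr// mul1r.
case: u => -[x y] xy; have := xy; rewrite normc_def /=.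
rewrite eq_complex /= eqxx andbT => /eqP sxy.
have xy1 : x ^+ 2 + y ^+ 2 = 1.
  by rewrite -(@sqr_sqrtr _ (x ^+ 2 + y ^+ 2)) ?sxy ?expr1n// addr_ge0// sqr_ge0.
have x1 : -1 <= x <= 1 by apply/andP; split; nra.
have yE : `|y| = sin (acos x).
  by rewrite sin_acos// -xy1 addrAC subrr add0r sqrtr_sqr.
have cx : cos (acos x) = x by rewrite acosK.
have [y0|y0] := leP 0 y.
  exists (acos x); first by rewrite acos_ge0//= (le_lt_trans (acos_lepi x1))//; lra.
  apply/val_inj/eqP; rewrite eq_complex /= cx -yE ger0_norm// !eqxx//.
exists (2 * pi - acos x); last first.
  apply/val_inj/eqP; rewrite eq_complex /= mulr_natl addrC cosD2pi sinD2pi cosN sinN cx -yE ltr0_norm// opprK !eqxx//.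
have : 0 < acos x.
  apply: acos_gt0; case/andP: x1 => -> x1 /=; nra.
have := acos_lepi x1; lra.
Qed.

Local Notation lam := (@lebesgue_measure R).

Lemma lam_shift (s : R) (A : set R) : measurable A ->
  lam ((fun t => t + s) @^-1` A) = lam A.
Proof.
have ms : measurable_fun [set: R] (fun t : R => t + s).
  by apply: measurable_funD.
move=> mA; apply/esym.
apply: (@lebesgue_measure_unique R (pushforward lam (fun t : measurableTypeR R => t + s : measurableTypeR R))) => //.
move=> _ [[a b] _ <-]; rewrite /pushforward /=.
transitivity (lam `]a - s, b - s]%classic); last first.
  by congr lam; apply/seteqP; split => x /=; rewrite !in_itv /=; lra.
rewrite !lebesgue_measure_itv /= !lte_fin ltrD2r.
by case: ifP => // _; rewrite -!EFinD; congr EFin; ring.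
Qed.

Lemma lam_periodic (B : set R) (s : R) : measurable B -> 0 <= s < 1 ->
  (forall t, B (t + 1) <-> B t) ->
  lam ((fun t => t + s) @^-1` B `&` `[0, 1[) = lam (B `&` `[0, 1[).
Proof.
move=> mB /andP[s0 s1] pB.
have mI (a b : R) : measurable (B `&` `[a, b[).
  by apply: measurableI.
have -> : (fun t => t + s) @^-1` B `&` `[0, 1[ =
    (fun t => t + s) @^-1` (B `&` `[s, 1 + s[).
  by apply/seteqP; split => x /= [Bx]; rewrite !in_itv /= => ?; split=> //; lra.
rewrite lam_shift//.
have -> : B `&` `[s, 1 + s[ = (B `&` `[s, 1[) `|` (B `&` `[1, 1 + s[).
  rewrite -setIUr; congr (_ `&` _); apply/seteqP; split => x /=; rewrite !in_itv /=.
    by move=> ?; case: (ltP x 1) => ?; [left|right]; lra.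
  by case; lra.
transitivity (lam (B `&` `[s, 1%R[) + lam (B `&` `[1%R, (1 + s)%R[))%E.
  apply: measureU; [exact: mI|exact: mI|].
  by apply/seteqP; split => // x /= [[_ +] [_]]; rewrite !in_itv /=; lra.
rewrite -(@lam_shift 1 (B `&` `[1, 1 + s[))//.
have -> : (fun t => t + 1) @^-1` (B `&` `[1, 1 + s[) = B `&` `[0, s[.
  by apply/seteqP; split => x /= [/pB Bx]; rewrite !in_itv /= => ?; split=> //; lra.
transitivity (lam ((B `&` `[s, 1[) `|` (B `&` `[0, s[))).
  apply/esym/measureU; [exact: mI|exact: mI|].
  by apply/seteqP; split => // x /= [[_ +] [_]]; rewrite !in_itv /=; lra.
congr lam; rewrite -setIUr; congr (_ `&` _); apply/seteqP; split => x /=; rewrite !in_itv /=.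
  by case; lra.
by move=> ?; case: (ltP x s) => ?; [right|left]; lra.
Qed.

(* The image of Lebesgue measure on [0, 1[ by t |-> e^(2 i pi t). *)
Lemma exists_haar : exists mu : probability (circle R) R, is_haar mu.
Proof.
have mI01 : measurable (`[0, 1[%classic : set R) by exact: measurable_itv.
have mT : mrestr lam mI01 setT = 1%E.
  by rewrite /mrestr setTI lebesgue_measure_itv /= lte_fin ltr01 oppr0 adde0.
pose P0 : probability (measurableTypeR R) R :=
  HB.pack_for (probability (measurableTypeR R) R) (mrestr lam mI01)
    (Measure_isProbability.Build _ _ _ (mrestr lam mI01) mT).
pose turn' : measurableTypeR R -> circle R := turn.
have mt : measurable_fun setT turn' by exact: measurable_turn.
pose mturn : {mfun measurableTypeR R >-> circle R} :=
  HB.pack turn' (isMeasurableFun.Build _ _ _ _ turn' mt).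
exists (distribution P0 mturn) => u A mA.
rewrite /distribution /pushforward /= /mrestr /=.
have [s s01 us] := turn_surj u^-1%g.
have mB : measurable (turn @^-1` A).
  by rewrite -[_ @^-1` _]setTI; exact: measurable_turn.
rewrite -(lam_periodic mB s01); last by move=> t /=; rewrite turnD1.
have tD t : turn (t + s) = (u^-1 * turn t)%g.
  by rewrite us -cisD -mulrDr addrC.
congr (lam (_ `&` _)); apply/seteqP; split => t /=; rewrite tD.
  by move=> [z Az zt]; rewrite -[turn t]zt mulKg.
by move=> At; exists (u^-1 * turn t)%g => //; rewrite mulVKg.
Qed.
End haar_existence.

Definition mutually_independent d (Omega : measurableType d) (R : realType)
    (P : probability Omega R) d' (T : measurableType d') (I : choiceType)
    (D : set I) (X : I -> Omega -> T) : Prop :=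
  forall (J : {fset I}) (A : I -> set T), [set` J] `<=` D ->
    (forall j, measurable (A j)) ->
    P (\bigcap_(j in [set` J]) (X j @^-1` A j)) =
    (\prod_(j <- J) P (X j @^-1` A j))%E.

(* The supremum is taken in the extended reals, because [sup] is 0 on sets that
   are not bounded above. *)
Definition C2 d (E : measurableType d) (R : realType) (rho : probability E R)
    (tau : E -> E) : set (E -> R) :=
  [set g : E -> R | rho.-integrable setT (EFin \o g) /\
    forall eps : R, 0 < eps -> \forall n \near \oo,
      (ereal_sup [set `| \sum_(1 <= i < n.+1)
         (g (iter i tau x) - \int[rho]_y g y) |%:E | x in setT]
       <= (eps * Num.sqrt n%:R)%:E)%E].

(* Main.v *)
Require Import Defs.
From mathcomp Require Import all_boot all_order all_algebra.
From mathcomp Require Import finmap complex.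
From mathcomp Require Import all_classical all_reals all_analysis.
From mathcomp Require Import measurable_realfun.
From mathcomp Require Import ring lra.

Import Order.TTheory GRing.Theory Num.Theory.
Import numFieldNormedType.Exports.

Local Open Scope classical_set_scope.
Local Open Scope ring_scope.
Set Implicit Arguments.
Unset Strict Implicit.
Unset Printing Implicit Defensive.

(** The conclusion holds for every starting point x. Put a = e^(2 i pi theta)
    and p_j = f(tau^j x). For an integer k <> 0, the k-th Fourier coefficient of
    the law of R_1...R_n is the product of the numbers
    p_j a^k + (1 - p_j) a^(-k), and
      |p a^k + (1 - p) a^(-k)|^2 = 1 - 4 p (1 - p) (Im a^k)^2.
    Since theta is irrational, Im a^k <> 0 ([irrational_char_im]), so this
    product tends to 0 as soon as the series of the p_j (1 - p_j) diverges
    ([walk_char_cvg]). It does: f (1 - f) is nonnegative and, f not being an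
    indicator function, its integral c is positive
    ([not_indicator_integral_gt0]); membership in C_2 says that the partial sums
    are n c + o(sqrt n), uniformly in x ([C2_sum_pinfty]). Weyl's criterion
    ([weyl_criterion]) turns the decay of all nontrivial Fourier coefficients
    into convergence in law to Haar measure.

    Weyl's criterion rests on the uniform density of trigonometric polynomials
    in the continuous functions on the circle. It is obtained by convolution
    with the de la Vallee-Poussin kernel, the normalized powers of
    cos^2(t / 2), in the manner of Bernstein's proof for intervals. The modulus
    of continuity of h is put in the form
      |h z - h w| <= e + K (1 - cos^2(t / 2)),  e^(it) = z / w,
    ([circle_modulus]), so that the approximation error is at most e plus K times
    the mean of 1 - cos^2(t / 2) under the kernel, which is exactly 1 / (2 N + 2)
    because the masses of consecutive powers are central binomial coefficients
    ([kernel_coefS]).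

    The expectation of h (R_1...R_n) is computed as a finite average
    [walk_mean], defined by conditioning on the last step; independence enters
    only in [walk_lawP], which identifies the two. *)

(** * Characters of the circle *)

Section characters.
Variable R : realType.
Implicit Types (u v w z : circle R) (k : int).

(** The character z |-> z^k is handled through its real and imaginary parts, so
    that all integrals below are integrals of real functions. *)
Definition char_re k z : R := complex.Re (val z ^ k).
Definition char_im k z : R := complex.Im (val z ^ k).

Lemma circle_val_neq0 u : val u != 0.
Proof. by rewrite -normr_eq0 circle_norm oner_neq0. Qed.

Lemma norm_exp_circle k u : `|val u ^ k| = 1.
Proof.
case: k => n; first by rewrite normrX circle_norm expr1n.
by rewrite NegzE -exprnN normfV normrX circle_norm expr1n invr1.
Qed.

Lemma char_norm k u : char_re k u ^+ 2 + char_im k u ^+ 2 = 1.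
Proof.
have := norm_exp_circle k u; rewrite normc_def => /eqP.
rewrite eq_complex /= eqxx andbT => /eqP s.
by rewrite -[LHS]sqr_sqrtr ?s ?expr1n// addr_ge0// sqr_ge0.
Qed.

Lemma exp_circleE k u : val u ^ k = (char_re k u +i* char_im k u)%C.
Proof. by rewrite /char_re /char_im; case: (_ ^ _). Qed.

Lemma char_re0 u : char_re 0 u = 1. Proof. by []. Qed.
Lemma char_im0 u : char_im 0 u = 0. Proof. by []. Qed.

Lemma exp_circleM k u v : val (u * v)%g ^ k = val u ^ k * val v ^ k.
Proof. exact: expfzMl. Qed.

Lemma char_reM k u v :
  char_re k (u * v)%g = char_re k u * char_re k v - char_im k u * char_im k v.
Proof. by rewrite {1}/char_re exp_circleM !exp_circleE. Qed.

Lemma char_imM k u v :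
  char_im k (u * v)%g = char_re k u * char_im k v + char_im k u * char_re k v.
Proof. by rewrite {1}/char_im exp_circleM !exp_circleE. Qed.

Lemma exp_circleV k u : val (u^-1)%g ^ k = (char_re k u +i* - char_im k u)%C.
Proof.
rewrite (_ : val _ = (val u)^-1)// exprz_inv -invr_expz.
apply/(mulfI (expfz_neq0 k (circle_val_neq0 u))).
rewrite mulfV ?expfz_neq0 ?circle_val_neq0// exp_circleE; apply/eqP.
rewrite eq_complex /=; apply/andP; split; apply/eqP; last by ring.
by rewrite -(char_norm k u); ring.
Qed.

Lemma char_reV k u : char_re k (u^-1)%g = char_re k u.
Proof. by rewrite {1}/char_re exp_circleV. Qed.

Lemma char_imV k u : char_im k (u^-1)%g = - char_im k u.
Proof. by rewrite {1}/char_im exp_circleV. Qed.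

Lemma char_re_quot k u v :
  char_re k (u * v^-1)%g = char_re k u * char_re k v + char_im k u * char_im k v.
Proof. by rewrite char_reM char_reV char_imV mulrN opprK. Qed.

Lemma char_reN k u : char_re (- k) u = char_re k u.
Proof. by rewrite -[RHS]char_reV {2}/char_re (_ : val _ = (val u)^-1)// exprz_inv. Qed.

Lemma char_imN k u : char_im (- k) u = - char_im k u.
Proof. by rewrite -[RHS]char_imV {2}/char_im (_ : val _ = (val u)^-1)// exprz_inv. Qed.

Lemma char_reS (n : nat) u :
  char_re n.+1 u = char_re 1 u * char_re n u - char_im 1 u * char_im n u.
Proof.
rewrite {1}/char_re -exprnP exprS -[val u ^+ n]/(val u ^ n%:Z).
by rewrite exp_circleE -[X in X * _]expr1z exp_circleE.
Qed.

Lemma char_imS (n : nat) u :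
  char_im n.+1 u = char_re 1 u * char_im n u + char_im 1 u * char_re n u.
Proof.
rewrite {1}/char_im -exprnP exprS -[val u ^+ n]/(val u ^ n%:Z).
by rewrite exp_circleE -[X in X * _]expr1z exp_circleE.
Qed.

Lemma char_re_le1 k u : `|char_re k u| <= 1.
Proof.
rewrite -(@expr_le1 _ 2)// real_normK ?num_real//.
by rewrite -(char_norm k u) lerDl sqr_ge0.
Qed.

Lemma circle_val_continuous : continuous (@circle_val R : circle R -> R[i]^o).
Proof. exact: initial_continuous. Qed.

Lemma mulr_circle_continuous u : continuous (fun z => (z * u)%g).
Proof.
apply: (@continuous_comp_initial (circle R) (circle R) (R[i]^o) (@circle_val R)).
move=> z; apply: (@cvgM R[i] _ (nbhs z)).
  exact: circle_val_continuous.
exact: cvg_cst.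
Qed.

Lemma mull_circle_continuous u : continuous (fun z => (u * z)%g).
Proof.
apply: (@continuous_comp_initial (circle R) (circle R) (R[i]^o) (@circle_val R)).
move=> z; apply: (@cvgM R[i] _ (nbhs z)); first exact: cvg_cst.
exact: circle_val_continuous.
Qed.

Lemma Re_le_normc (x : R[i]) : (`|complex.Re x|%:C <= `|x|)%C.
Proof.
by rewrite normc_def lecR -sqrtr_sqr ler_wsqrtr// lerDl sqr_ge0.
Qed.

Lemma Im_le_normc (x : R[i]) : (`|complex.Im x|%:C <= `|x|)%C.
Proof.
by rewrite normc_def lecR -sqrtr_sqr ler_wsqrtr// lerDr sqr_ge0.
Qed.

Lemma Re_continuous : continuous (fun x : R[i]^o => complex.Re x).
Proof.
move=> x; apply/(@cvgrPdist_lt _ R _ (nbhs (x : R[i]^o))) => e e0; near=> y.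
rewrite -(@ltcR R) -[X in `|X|](raddfB (@complex.Re R)).
apply: le_lt_trans (Re_le_normc _) _; near: y.
by move/cvgrPdist_lt : (@cvg_id _ (nbhs x)); apply; rewrite ltcR.
Unshelve. all: by end_near. Qed.

Lemma Im_continuous : continuous (fun x : R[i]^o => complex.Im x).
Proof.
move=> x; apply/(@cvgrPdist_lt _ R _ (nbhs (x : R[i]^o))) => e e0; near=> y.
rewrite -(@ltcR R) -[X in `|X|](raddfB (@complex.Im R)).
apply: le_lt_trans (Im_le_normc _) _; near: y.
by move/cvgrPdist_lt : (@cvg_id _ (nbhs x)); apply; rewrite ltcR.
Unshelve. all: by end_near. Qed.

Lemma char_continuous_nat (n : nat) :
  continuous (char_re n) /\ continuous (char_im n).
Proof.
have c1 : continuous (char_re 1).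
  rewrite (_ : char_re 1 = (fun x : R[i]^o => complex.Re x) \o @circle_val R)//.
  move=> z; apply: (@continuous_comp _ (R[i]^o) _ _ (fun x => complex.Re x)).
    exact: circle_val_continuous.
  exact: Re_continuous.
have s1 : continuous (char_im 1).
  rewrite (_ : char_im 1 = (fun x : R[i]^o => complex.Im x) \o @circle_val R)//.
  move=> z; apply: (@continuous_comp _ (R[i]^o) _ _ (fun x => complex.Im x)).
    exact: circle_val_continuous.
  exact: Im_continuous.
elim: n => [|n [cn sn]].
  rewrite (_ : char_re 0 = cst 1); last by apply/funext.
  rewrite (_ : char_im 0 = cst 0); last by apply/funext.
  by split; exact: cst_continuous.
split=> z.
  rewrite (_ : char_re _ =
      fun z => char_re 1 z * char_re n z - char_im 1 z * char_im n z).
    by apply: (@cvgB _ R _ (nbhs z)); apply: (@cvgM R _ (nbhs z));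
      [exact: c1|exact: cn|exact: s1|exact: sn].
  by apply/funext => ?; exact: char_reS.
rewrite (_ : char_im _ = fun z => char_re 1 z * char_im n z + char_im 1 z * char_re n z).
  by apply: (@cvgD _ R _ (nbhs z)); apply: (@cvgM R _ (nbhs z));
    [exact: c1|exact: sn|exact: s1|exact: cn].
by apply/funext => ?; exact: char_imS.
Qed.

Lemma char_re_continuous k : continuous (char_re k).
Proof.
case: (intP k) => [|n|n];
  [exact: (char_continuous_nat 0).1|exact: (char_continuous_nat _).1|].
rewrite (_ : char_re _ = char_re n.+1) ?(funext (char_reN _))//.
exact: (char_continuous_nat _).1.
Qed.

Lemma char_im_continuous k : continuous (char_im k).
Proof.
case: (intP k) => [|n|n];
  [exact: (char_continuous_nat 0).2|exact: (char_continuous_nat _).2|].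
rewrite (_ : char_im _ = \- char_im n.+1); last by apply/funext => z; exact: char_imN.
by move=> z; apply: (@cvgN _ R _ (nbhs z)); exact: (char_continuous_nat _).2.
Qed.

Lemma continuous_circle_measurable (h : circle R -> R) :
  continuous h -> measurable_fun setT h.
Proof.
move=> ch; apply: (measurability _ (RGenOpens.measurableE R)).
move=> _ [_ [a [b ->]] <-]; rewrite setTI; apply: sub_sigma_algebra.
by apply: open_comp => // x _; exact: ch.
Qed.

Lemma continuous_circle_measurable_self (h : circle R -> circle R) :
  continuous h -> measurable_fun setT h.
Proof.
move=> ch; apply: (@measurability _ _ _ (circle R) _ _ (@open (circle R))) => //.
move=> _ [B oB <-]; rewrite setTI; apply: sub_sigma_algebra.
by apply: open_comp => // x _; exact: ch.
Qed.

End characters.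
(** * Moduli of continuity on the circle *)

Section modulus.
Variable R : realType.
Implicit Types (u v w z : circle R).

(** At e^(it) this is cos^2(t / 2): it lies in [0, 1] and takes the value 1 only
    at the identity, so its powers concentrate there. *)
Definition bump u : R := (1 + char_re 1 u) / 2.

Lemma bump_ge0 u : 0 <= bump u.
Proof.
by rewrite /bump divr_ge0//; have := char_re_le1 1 u; rewrite ler_norml; lra.
Qed.

Lemma bump_le1 u : bump u <= 1.
Proof. by rewrite /bump; have := char_re_le1 1 u; rewrite ler_norml; lra. Qed.

Lemma bump_eq1 u : bump u = 1 -> u = 1%g.
Proof.
rewrite /bump => b1; have re1 : char_re 1 u = 1 by lra.
have := char_norm 1 u; rewrite re1 expr1n => /eqP.
rewrite -subr_eq0 addrAC subrr add0r sqrf_eq0 => /eqP im0.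
by apply/val_inj; rewrite -[LHS]expr1z exp_circleE re1 im0.
Qed.

Lemma bump_continuous : continuous bump.
Proof.
move=> z; apply: (@cvgM R _ (nbhs z)); last exact: cvg_cst.
by apply: (@cvgD _ R _ (nbhs z)); [exact: cvg_cst|exact: char_re_continuous].
Qed.

Lemma bump_turn (s t : R) :
  bump (turn s * (turn t)^-1)%g = (1 + cos (2 * pi * (s - t))) / 2.
Proof.
rewrite /bump char_re_quot /char_re /char_im !expr1z /=.
by rewrite mulrBr cosB.
Qed.

(** For fixed z and w the bound holds strictly for large K: by the slack e when
    z = w, and because 1 - bump (z / w) > 0 otherwise. Compactness of the square
    of angles makes K uniform. The right-hand side is affine in bump because it
    is to be integrated against powers of bump. *)
Lemma circle_modulus (h : circle R -> R) (e : R) : continuous h -> 0 < e ->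
  exists2 K : R, 0 <= K & forall z w, `|h z - h w| <= e + K * (1 - bump (z * w^-1)%g).
Proof.
move=> ch e0.
pose F (n : nat) (p : R * R) : R :=
  e + n%:R * (1 - bump (turn p.1 * (turn p.2)^-1)%g)
    - `|h (turn p.1) - h (turn p.2)|.
have cF n : continuous (F n).
  move=> p.
  have c1 : h (turn q.1) @[q --> p] --> h (turn p.1).
    apply: (@continuous_comp _ _ _ fst (h \o @turn R)); first exact: cvg_fst.
    by apply: continuous_comp; [exact: continuous_turn|exact: ch].
  have c2 : h (turn q.2) @[q --> p] --> h (turn p.2).
    apply: (@continuous_comp _ _ _ snd (h \o @turn R)); first exact: cvg_snd.
    by apply: continuous_comp; [exact: continuous_turn|exact: ch].
  apply: cvgB; last by apply: cvg_norm; exact: cvgB.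
  apply: cvgD; first exact: cvg_cst.
  apply: cvgM; first exact: cvg_cst.
  apply: cvgB; first exact: cvg_cst.
  under eq_fun do rewrite bump_turn; rewrite bump_turn.
  apply: cvgM; last exact: cvg_cst.
  apply: cvgD; first exact: cvg_cst.
  apply: (@continuous_comp _ _ _ (fun q : R * R => 2 * pi * (q.1 - q.2)) (@cos R)).
    by apply: cvgM; [exact: cvg_cst|apply: cvgB; [exact: cvg_fst|exact: cvg_snd]].
  exact: continuous_cos.
have : compact (`[0, 1] `*` `[0, 1] : set (R * R)).
  by apply: compact_setX; exact: segment_compact.
have F_mono n m p : (n <= m)%N -> F n p <= F m p.
  move=> nm; rewrite /F lerD2r lerD2l ler_wpM2r ?ler_nat//.
  by rewrite subr_ge0 bump_le1.
move/compact_near_coveringP => /(_ nat \oo (fun n p => 0 < F n p)) [].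
  move=> [s t] _.
  have [n F0] : exists n, 0 < F n (s, t).
    have [b1|b1] := eqVneq (bump (turn s * (turn t)^-1)%g) 1.
      exists 0%N => //=; rewrite /F /= mul0r addr0.
      move/bump_eq1 : b1 => /(congr1 (fun x => x * turn t)%g).
      by rewrite mulgVK mul1g => ->; rewrite subrr normr0 subr0.
    have b : 0 < 1 - bump (turn s * (turn t)^-1)%g.
      by rewrite subr_gt0 lt_neqAle b1 bump_le1.
    exists (Num.truncn (`|h (turn s) - h (turn t)| /
                        (1 - bump (turn s * (turn t)^-1)%g))).+1.
    rewrite /F /= subr_gt0 ltr_wpDl ?(ltW e0)// -ltr_pdivrMr//.
    by rewrite truncnS_gt.
  exists ([set p | 0 < F n p], [set m | (n <= m)%N]) => /=.
    split; last by exists n.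
    apply: (cF n (s, t) [set x | 0 < x]).
    by apply: open_nbhs_nbhs; split => //; exact: open_gt.
  by move=> [p m] /= [Fp nm]; exact: lt_le_trans (F_mono _ _ _ nm).
move=> n _ /(_ n (leqnn n)) cov.
exists n%:R => // z w.
have [s /andP[s0 s1] ->] := turn_surj z; have [t /andP[t0 t1] ->] := turn_surj w.
have st : (`[0, 1] `*` `[0, 1]) (s, t) by rewrite /= !in_itv /= s0 t0 !ltW.
by have /= := cov (s, t) st; rewrite /F subr_gt0 => /ltW.
Qed.

End modulus.
(** * Haar integrals of characters *)

Section haar.
Variable R : realType.
Implicit Types (u v w z : circle R) (mu : probability (circle R) R).

Lemma char_turn_nat (n : nat) (t : R) :
  char_re n (turn t) = cos (2 * pi * t * n%:R) /\
  char_im n (turn t) = sin (2 * pi * t * n%:R).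
Proof.
elim: n => [|n [cn sn]]; first by rewrite mulr0 cos0 sin0 char_re0 char_im0.
have -> : 2 * pi * t * n.+1%:R = 2 * pi * t * n%:R + 2 * pi * t.
  by rewrite -natr1; ring.
rewrite char_reS char_imS cn sn cosD sinD.
by rewrite /char_re /char_im !expr1z /=; split; ring.
Qed.

Lemma char_re_turn (k : int) (t : R) :
  char_re k (turn t) = cos (2 * pi * t * k%:~R).
Proof.
case: (intP k) => [|n|n]; [exact: (char_turn_nat 0 t).1|exact: (char_turn_nat _ t).1|].
by rewrite char_reN mulrNz mulrN cosN; exact: (char_turn_nat _ t).1.
Qed.

Lemma char_im_turn (k : int) (t : R) :
  char_im k (turn t) = sin (2 * pi * t * k%:~R).
Proof.
case: (intP k) => [|n|n]; [exact: (char_turn_nat 0 t).2|exact: (char_turn_nat _ t).2|].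
by rewrite char_imN mulrNz mulrN sinN; congr (- _); exact: (char_turn_nat _ t).2.
Qed.

Lemma circle_continuous_bounded (h : circle R -> R) : continuous h ->
  exists2 M : R, 0 <= M & forall z, `|h z| <= M.
Proof.
move=> /circle_modulus/(_ ltr01)[K K0 hK]; exists (`|h 1%g| + (1 + K)).
  by rewrite addr_ge0// addr_ge0.
move=> z; rewrite -[h z](subrK (h 1%g)) addrC (le_trans (ler_normD _ _))// lerD2l.
apply: le_trans (hK _ _) _; rewrite lerD2l ler_piMr// gerBl.
exact: bump_ge0.
Qed.

Lemma circle_continuous_integrable mu (h : circle R -> R) : continuous h ->
  mu.-integrable setT (EFin \o h).
Proof.
move=> ch; apply: measurable_bounded_integrable => //.
- exact: le_lt_trans (probability_le1 mu measurableT) (ltry 1).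
- exact: continuous_circle_measurable.
have [M M0 hM] := circle_continuous_bounded ch.
exists M; split; first by rewrite num_real.
by move=> x Mx z _ /=; exact: le_trans (hM z) (ltW Mx).
Qed.

Lemma haar_translate mu (h : circle R -> R) u : is_haar mu -> continuous h ->
  \int[mu]_z h (u * z)%g = \int[mu]_z h z.
Proof.
move=> hmu ch; congr fine.
have mu_ : measurable_fun setT (fun z : circle R => (u * z)%g).
  exact: continuous_circle_measurable_self (@mull_circle_continuous R u).
have mh := continuous_circle_measurable ch.
have chu : continuous (fun z => h (u * z)%g).
  move=> z; apply: (@continuous_comp _ _ _ (fun z => (u * z)%g) h); last exact: ch.
  exact: mull_circle_continuous.
transitivity (\int[pushforward mu (fun z : circle R => (u * z)%g)]_z (h z)%:E)%E.
  rewrite integral_pushforward//; first exact/measurable_EFinP.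
  exact: (circle_continuous_integrable mu chu).
apply: eq_measure_integral => A mA _; rewrite /pushforward /=.
rewrite -[in RHS](hmu u^-1%g)//; congr (mu _); apply/seteqP; split => z /=.
  by move=> Az; exists (u * z)%g => //; rewrite mulKg.
by move=> [y Ay <-]; rewrite mulVKg.
Qed.

(** Translation by a k-th root of -1 preserves the integral and changes the sign
    of z^k. *)
Lemma haar_char mu (k : int) : is_haar mu -> k != 0 ->
  \int[mu]_z char_re k z = 0 /\ \int[mu]_z char_im k z = 0.
Proof.
move=> hmu k0; set t : R := (2 * k%:~R)^-1.
have k0R : k%:~R != 0 :> R by rewrite intr_eq0.
have tk : 2 * pi * t * k%:~R = pi :> R by rewrite /t; field.
have ret : char_re k (turn t) = -1 by rewrite char_re_turn tk cospi.
have imt : char_im k (turn t) = 0 by rewrite char_im_turn tk sinpi.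
have oppI (c : circle R -> R) : continuous c ->
    (forall z, c (turn t * z)%g = - c z) -> \int[mu]_z c z = 0.
  move=> cc cN; have := haar_translate (turn t) hmu cc.
  under eq_Rintegral do rewrite cN -mulN1r.
  rewrite RintegralZl//; last exact: circle_continuous_integrable.
  by rewrite mulN1r => I; lra.
split; apply: oppI.
- exact: char_re_continuous.
- by move=> z; rewrite char_reM ret imt; ring.
- exact: char_im_continuous.
- by move=> z; rewrite char_imM ret imt; ring.
Qed.

Lemma continuous_sum (I : Type) (r : seq I) (h : I -> circle R -> R) :
  (forall i, continuous (h i)) -> continuous (fun z => \sum_(i <- r) h i z).
Proof.
move=> ch; elim: r => [|i r IH].
  rewrite (_ : (fun _ => _) = cst 0); first exact: cst_continuous.
  by apply/funext => z; rewrite big_nil.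
rewrite (_ : (fun _ => _) = fun z => h i z + \sum_(i <- r) h i z).
  by move=> z; apply: (@cvgD _ R _ (nbhs z)); [exact: ch|exact: IH].
by apply/funext => z; rewrite big_cons.
Qed.

Lemma Rintegral_sum mu (I : Type) (r : seq I) (h : I -> circle R -> R) :
  (forall i, continuous (h i)) ->
  \int[mu]_z (\sum_(i <- r) h i z) = \sum_(i <- r) \int[mu]_z h i z.
Proof.
move=> ch; elim: r => [|i r IH].
  under eq_Rintegral do rewrite big_nil.
  by rewrite big_nil Rintegral_cst// mul0r.
under eq_Rintegral do rewrite big_cons.
rewrite big_cons RintegralD ?IH//; first exact: circle_continuous_integrable.
apply: circle_continuous_integrable.
exact: continuous_sum.
Qed.

Lemma Rintegral_circle_cst mu (c : R) : \int[mu]_(z in setT) c = c.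
Proof.
transitivity (c * fine (mu setT)); first exact: Rintegral_cst.
by rewrite probability_setT mulr1.
Qed.

End haar.
(** * The de la Vallee-Poussin kernel and Weyl's criterion *)

Section kernel.
Variable R : realType.
Implicit Types (u v w z : circle R) (mu : probability (circle R) R) (N : nat).

(** The Fourier coefficient of index j - N of bump^N; the central one, j = N, is
    the Haar integral of bump^N. *)
Definition kernel_coef N (j : nat) : R := 'C(N.*2, j)%:R / 4 ^+ N.

Lemma kernel_coef_gt0 N : 0 < kernel_coef N N.
Proof.
rewrite divr_gt0 ?exprn_gt0// ltr0n bin_gt0 -addnn; exact: leq_addr.
Qed.

(** This ratio of consecutive masses says that 1 - bump has mean 1 / (2 N + 2)
    under the normalized kernel: it is the rate at which the kernel
    concentrates. *)
Lemma kernel_coefS N :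
  kernel_coef N.+1 N.+1 = kernel_coef N N * (1 - ((N.+1).*2%:R)^-1).
Proof.
have H : ('C(N.+1.*2, N.+1) * (N.+1) = 'C(N.*2, N) * 2 * (N.*2.+1))%N.
  have fN : (0 < N.+1`! * N`!)%N by rewrite muln_gt0 !fact_gt0.
  apply/eqP; rewrite -(eqn_pmul2r fN); apply/eqP.
  have := @bin_fact N.+1.*2 N.+1; have := @bin_fact N.*2 N.
  rewrite -!addnn leq_addr addnK => /(_ isT) E /(_ (leq_addr _ _)).
  rewrite addnK => E'.
  transitivity ('C(N.+1 + N.+1, N.+1) * (N.+1`! * N.+1`!))%N.
    by rewrite factS; ring.
  by rewrite E' addSn addnS !factS -E; ring.
have HR := congr1 (fun n => n%:R : R) H.
rewrite /= !natrM in HR.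
have N0 : N.+1%:R != 0 :> R by rewrite pnatr_eq0.
rewrite /kernel_coef exprS.
have -> : N.+1.*2%:R = 2 * N.+1%:R :> R by rewrite -mul2n natrM.
have -> : 'C(N.+1.*2, N.+1)%:R = 'C(N.*2, N)%:R * 2 * N.*2.+1%:R / N.+1%:R :> R.
  by rewrite -HR mulfK.
have -> : N.*2.+1%:R = 2 * N.+1%:R - 1 :> R.
  by rewrite -[LHS]natr1 -mul2n natrM -[N.+1%:R]natr1; ring.
have y0 : 4 ^+ N != 0 :> R by rewrite expf_neq0// pnatr_eq0.
move: (N.+1%:R : R) N0 (4 ^+ N : R) y0 => a a0 b b0.
by field; rewrite a0 b0.
Qed.

(** Expand bump u = (1 + u)^2 / (4 u) by the binomial theorem and take real
    parts. *)
Lemma bump_exp N u : bump u ^+ N =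
  \sum_(j < N.*2.+1) kernel_coef N j * char_re (j%:Z - N%:Z) u.
Proof.
set x := val u; have x0 : x != 0 := circle_val_neq0 u.
have bE : (bump u)%:C%C = (1 + x) ^+ 2 / (4 * x).
  have xE : x = (char_re 1 u +i* char_im 1 u)%C by rewrite -exp_circleE expr1z.
  apply: (canRL (mulfK _)); first by rewrite mulf_neq0// pnatr_eq0.
  have := char_norm 1 u; rewrite xE /bump.
  move: (char_re 1 u) (char_im 1 u) => a b ab; apply/eqP; rewrite eq_complex /=.
  by apply/andP; split; apply/eqP; rewrite ?expr2 /=; nra.
have E : (bump u ^+ N)%:C%C =
    \sum_(j < N.*2.+1) (kernel_coef N j)%:C%C * x ^ (j%:Z - N%:Z).
  rewrite rmorphXn /= bE expr_div_n -exprM mul2n exprDn mulr_suml.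
  apply: eq_bigr => j _; rewrite expr1n mul1r -mulr_natl.
  rewrite /kernel_coef rmorphM fmorphV rmorphXn !rmorph_nat.
  rewrite expfzDr// -invr_expz exprMn.
  by rewrite invfM -!exprnP mulrACA.
rewrite -[LHS]/(complex.Re (bump u ^+ N)%:C%C) E raddf_sum /=.
by apply: eq_bigr => j _; rewrite exp_circleE /=; ring.
Qed.

Lemma quot_circle_continuous z : continuous (fun w => bump (z * w^-1)%g).
Proof.
rewrite (_ : (fun _ => _) = fun w => bump (w * z^-1)%g).
  move=> w; apply: (@continuous_comp _ _ _ (fun w => (w * z^-1)%g) (@bump R)).
    exact: mulr_circle_continuous.
  exact: bump_continuous.
by apply/funext => w; rewrite /bump !char_re_quot; ring.
Qed.

Lemma bump_exp_continuous z N : continuous (fun w => bump (z * w^-1)%g ^+ N).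
Proof.
elim: N => [|N IH]; first exact: cst_continuous.
rewrite (_ : (fun _ => _) = fun w => bump (z * w^-1)%g * bump (z * w^-1)%g ^+ N).
  by move=> w; apply: (@cvgM R _ (nbhs w)); [exact: quot_circle_continuous|exact: IH].
by apply/funext => w; rewrite exprS.
Qed.

Lemma continuousM_circle (f g : circle R -> R) :
  continuous f -> continuous g -> continuous (fun z => f z * g z).
Proof. by move=> cf cg z; apply: (@cvgM R _ (nbhs z)); [exact: cf|exact: cg]. Qed.

Lemma continuousD_circle (f g : circle R -> R) :
  continuous f -> continuous g -> continuous (fun z => f z + g z).
Proof. by move=> cf cg z; apply: (@cvgD _ R _ (nbhs z)); [exact: cf|exact: cg]. Qed.

Lemma continuousZ_circle (c : R) (f : circle R -> R) :
  continuous f -> continuous (fun z => c * f z).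
Proof. by move=> cf; apply: continuousM_circle => //; exact: cst_continuous. Qed.

(** The convolution of h with bump^N. It is defined through the Fourier
    coefficients of h, which makes it a trigonometric polynomial by
    construction; [bump_convE] recovers the integral. *)
Definition bump_conv mu (h : circle R -> R) N z : R :=
  \sum_(j < N.*2.+1) kernel_coef N j *
    (\int[mu]_w (h w * char_re (j%:Z - N%:Z) w) * char_re (j%:Z - N%:Z) z +
     \int[mu]_w (h w * char_im (j%:Z - N%:Z) w) * char_im (j%:Z - N%:Z) z).

Lemma bump_convE mu (h : circle R -> R) N z : continuous h ->
  bump_conv mu h N z = \int[mu]_w (h w * bump (z * w^-1)%g ^+ N).
Proof.
move=> ch.
have cr k : continuous (fun w => h w * char_re k w).
  by apply: continuousM_circle => //; exact: char_re_continuous.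
have ci k : continuous (fun w => h w * char_im k w).
  by apply: continuousM_circle => //; exact: char_im_continuous.
pose F (j : 'I_N.*2.+1) w := kernel_coef N j *
    (char_re (j%:Z - N%:Z) z * (h w * char_re (j%:Z - N%:Z) w) +
     char_im (j%:Z - N%:Z) z * (h w * char_im (j%:Z - N%:Z) w)).
transitivity (\int[mu]_w (\sum_(j < N.*2.+1) F j w)); last first.
  apply: eq_Rintegral => w _; rewrite bump_exp mulr_sumr.
  by apply: eq_bigr => j _; rewrite char_re_quot /F; ring.
rewrite Rintegral_sum => [|j]; last first.
  by apply/continuousZ_circle/continuousD_circle; exact: continuousZ_circle.
apply: eq_bigr => j _; rewrite /F RintegralZl//; last first.
  apply: circle_continuous_integrable.
  by apply: continuousD_circle; exact: continuousZ_circle.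
rewrite RintegralD ?RintegralZl//;
  try (apply: circle_continuous_integrable => //; exact: continuousZ_circle).
by congr (_ * (_ + _)); rewrite mulrC.
Qed.

(** Only the term of index 0 of the expansion of bump^N has a nonzero
    integral. *)
Lemma kernel_mass mu N z : is_haar mu ->
  \int[mu]_w bump (z * w^-1)%g ^+ N = kernel_coef N N.
Proof.
move=> hmu; have := @bump_convE mu (cst 1) N z (@cst_continuous _ _ _).
under [RHS]eq_Rintegral do rewrite mul1r.
move=> <-; rewrite /bump_conv.
have Ire k : \int[mu]_w (cst 1 w * char_re k w) = \int[mu]_w char_re k w.
  by apply: eq_Rintegral => w _; rewrite mul1r.
have Iim k : \int[mu]_w (cst 1 w * char_im k w) = \int[mu]_w char_im k w.
  by apply: eq_Rintegral => w _; rewrite mul1r.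
have N1 : (N < N.*2.+1)%N by rewrite ltnS -addnn leq_addr.
rewrite (bigD1 (Ordinal N1))//= subrr big1 ?addr0.
  rewrite Ire char_re0 char_im0 mulr0 addr0 mulr1.
  under eq_Rintegral do rewrite char_re0.
  by rewrite Rintegral_circle_cst mulr1.
move=> j /negP jN.
have k0 : j%:Z - N%:Z != 0.
  by rewrite subr_eq0; apply/negP => /eqP [E]; apply/jN/eqP/val_inj.
have [re0 im0] := haar_char hmu k0.
by rewrite Ire Iim re0 im0 !mul0r addr0 mulr0.
Qed.

(** Integrate the bound on h z - h w against the kernel: the constant e is
    preserved and 1 - bump contributes its mean. *)
Lemma bump_conv_approx mu (h : circle R -> R) (e K : R) N z :
  is_haar mu -> continuous h -> 0 <= K ->
  (forall z w, `|h z - h w| <= e + K * (1 - bump (z * w^-1)%g)) ->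
  `|h z - bump_conv mu h N z / kernel_coef N N| <= e + K / (N.+1).*2%:R.
Proof.
move=> hmu ch K0 hK; have c0 := kernel_coef_gt0 N.
have cb n := @bump_exp_continuous z n.
have ib n : mu.-integrable setT (EFin \o (fun w => bump (z * w^-1)%g ^+ n)).
  exact: circle_continuous_integrable.
have chb : continuous (fun w => h w * bump (z * w^-1)%g ^+ N).
  exact: continuousM_circle.
have chz : continuous (fun w => h z * bump (z * w^-1)%g ^+ N).
  exact: continuousZ_circle.
have E : h z * kernel_coef N N - bump_conv mu h N z =
    \int[mu]_w (h z * bump (z * w^-1)%g ^+ N - h w * bump (z * w^-1)%g ^+ N).
  rewrite RintegralB//; try exact: circle_continuous_integrable.
  by rewrite bump_convE// RintegralZl// kernel_mass.
have -> : h z - bump_conv mu h N z / kernel_coef N N =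
    (h z * kernel_coef N N - bump_conv mu h N z) / kernel_coef N N.
  by field; rewrite gt_eqF.
rewrite normrM normfV (gtr0_norm c0) ler_pdivrMr// E.
apply: le_trans (le_normr_Rintegral _ _) _ => //.
  apply: (@circle_continuous_integrable _ _ (fun w => _ - _)).
  rewrite (_ : (fun _ => _) = fun w => h z * bump (z * w^-1)%g ^+ N +
      (-1) * (h w * bump (z * w^-1)%g ^+ N)).
    by apply: continuousD_circle; exact: continuousZ_circle.
  by apply/funext => w; ring.
apply: (@le_trans _ _ (\int[mu]_w ((e + K) * bump (z * w^-1)%g ^+ N +
    (- K) * bump (z * w^-1)%g ^+ N.+1))).
  apply: le_Rintegral => //.
  - apply: (@circle_continuous_integrable _ _ (fun w => `|_ - _|)).
    move=> w; apply: (@cvg_norm _ R _ (nbhs w)).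
    by apply: (@cvgB _ R _ (nbhs w)); [exact: chz|exact: chb].
  - apply: (@circle_continuous_integrable _ _ (fun w => _ + _)).
    by apply: continuousD_circle; exact: continuousZ_circle.
  - move=> w _; rewrite -mulrBl normrM [X in _ * X]ger0_norm ?exprn_ge0 ?bump_ge0//.
    rewrite (_ : _ + _ = (e + K * (1 - bump (z * w^-1)%g)) * bump (z * w^-1)%g ^+ N).
      by rewrite ler_wpM2r// exprn_ge0// bump_ge0.
    by rewrite exprS; ring.
rewrite RintegralD//;
  try (apply: (@circle_continuous_integrable _ _ (fun w => _ * _));
       exact: continuousZ_circle).
rewrite !RintegralZl// !kernel_mass// kernel_coefS le_eqVlt; apply/orP; left; apply/eqP.
ring.
Qed.

Lemma bump_conv_unif mu (h : circle R -> R) (e : R) :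
  is_haar mu -> continuous h -> 0 < e ->
  \forall N \near \oo, forall z,
    `|h z - bump_conv mu h N z / kernel_coef N N| < e.
Proof.
move=> hmu ch e0; have e2 : 0 < e / 2 by rewrite divr_gt0.
have [K K0 hK] := circle_modulus ch e2.
near=> N => z.
have := bump_conv_approx N z hmu ch K0 hK.
suff : K / (N.+1).*2%:R < e / 2 by lra.
rewrite ltr_pdivrMr ?ltr0n// mulrC -ltr_pdivrMr//.
apply: lt_le_trans (truncnS_gt _) _; rewrite ler_nat.
have NK : (Num.truncn (K / (e / 2)) <= N)%N by near: N; exact: nbhs_infty_ge.
by rewrite -addnn (leq_trans _ (leq_addr _ _)).
Unshelve. all: by end_near. Qed.

(** The functionals L n stand for expectations under a sequence of laws; they
    are only required to be linear, monotone and normalized. On the polynomial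
    [bump_conv mu h N] the limit is read off the constant term, which is the
    integral of h up to normalization, and the uniform approximation of h
    concludes. *)
Lemma weyl_criterion mu (L : nat -> (circle R -> R) -> R) :
  is_haar mu ->
  (forall n a f g, L n (fun z => a * f z + g z) = a * L n f + L n g) ->
  (forall n f g, (forall z, f z <= g z) -> L n f <= L n g) ->
  (forall n, L n (cst 1) = 1) ->
  (forall k : int, k != 0 -> L n (char_re k) @[n --> \oo] --> (0 : R)) ->
  (forall k : int, k != 0 -> L n (char_im k) @[n --> \oo] --> (0 : R)) ->
  forall h, continuous h -> L n h @[n --> \oo] --> \int[mu]_z h z.
Proof.
move=> hmu Llin Lmono L1 Lre Lim h ch.
have L0 n : L n (cst 0) = 0.
  have := Llin n (-1) (cst 0) (cst 0).
  rewrite (_ : (fun _ => _) = cst 0); last by apply/funext => z /=; ring.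
  by move=> E; lra.
have Lclose n f g d : (forall z, `|f z - g z| <= d) -> `|L n f - L n g| <= d.
  move=> fg; rewrite ler_norml lerBlDr lerBrDr; apply/andP; split.
    have := Lmono n (fun z => (- d) * cst 1 z + g z) f.
    rewrite Llin L1 mulr1; apply=> z /=.
    by have := fg z; rewrite ler_norml; lra.
  have := Lmono n f (fun z => d * cst 1 z + g z).
  rewrite Llin L1 mulr1; apply=> z /=.
  by have := fg z; rewrite ler_norml; lra.
have Lsum (I : Type) (r : seq I) (F : I -> circle R -> R) (l : I -> R) :
    (forall i, L n (F i) @[n --> \oo] --> l i) ->
    L n (fun z => \sum_(i <- r) F i z) @[n --> \oo] --> \sum_(i <- r) l i.
  move=> Fl; elim: r => [|i r IH].
    rewrite big_nil (_ : (fun _ => _) = cst 0); first exact: cvg_cst.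
    apply/funext => n; rewrite -[RHS](L0 n); congr L.
    by apply/funext => z; rewrite big_nil.
  rewrite big_cons (_ : (fun _ => _) =
      fun n => L n (F i) + L n (fun z => \sum_(i <- r) F i z)).
    by apply: cvgD.
  apply/funext => n; rewrite -[X in X + _]mul1r -Llin; congr L.
  by apply/funext => z; rewrite big_cons mul1r.
have Lconv N : L n (fun z => bump_conv mu h N z / kernel_coef N N) @[n --> \oo]
    --> \int[mu]_z h z.
  have c0 := kernel_coef_gt0 N.
  pose A (j : nat) := \int[mu]_w (h w * char_re (j%:Z - N%:Z) w).
  pose B (j : nat) := \int[mu]_w (h w * char_im (j%:Z - N%:Z) w).
  pose c (j : nat) := kernel_coef N j / kernel_coef N N.
  pose l (j : nat) := if j == N then \int[mu]_z h z else 0.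
  have -> : \int[mu]_z h z = \sum_(j < N.*2.+1) l j.
    have N1 : (N < N.*2.+1)%N by rewrite ltnS -addnn leq_addr.
    rewrite (bigD1 (Ordinal N1))//= /l eqxx big1 ?addr0//.
    by move=> j; rewrite -val_eqE /= => /negbTE ->.
  have := @Lsum _ (index_enum 'I_N.*2.+1)
    (fun j z => c j * A j * char_re (j%:Z - N%:Z) z +
                (c j * B j * char_im (j%:Z - N%:Z) z + cst 0 z))
    (fun j => l j).
  rewrite (_ : (fun z => \sum_(j < _) _) =
      fun z => bump_conv mu h N z / kernel_coef N N); last first.
    apply/funext => z; rewrite /bump_conv mulr_suml; apply: eq_bigr => j _.
    by rewrite /A /B /c /=; ring.
  apply=> j; rewrite /l.
  under eq_fun do rewrite !Llin L0 addr0.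
  (* The index j = N is the constant character; all others vanish in the limit. *)
  have [jN|jN] := eqVneq (j : nat) N; last first.
    have k0 : (j : nat)%:Z - N%:Z != 0.
      by rewrite subr_eq0; apply/negP => /eqP [E]; rewrite E eqxx in jN.
    rewrite (_ : 0 = c j * A j * 0 + c j * B j * 0); last by ring.
    by apply: cvgD; apply: cvgMr; [exact: Lre|exact: Lim].
  have E n : c j * A j * L n (char_re (j%:Z - N%:Z)) +
      c j * B j * L n (char_im (j%:Z - N%:Z)) = \int[mu]_z h z.
    rewrite /A /B /c jN subrr divff ?gt_eqF// !mul1r.
    rewrite (_ : char_re 0 = cst 1); last by apply/funext.
    rewrite (_ : char_im 0 = cst 0); last by apply/funext.
    rewrite L1 L0 mulr0 addr0 mulr1.
    by apply: eq_Rintegral => w _; rewrite mulr1.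
  by apply: cvg_near_cst; apply: nearW => n; exact: E.
apply/cvgrPdist_lt => e e0.
have e3 : 0 < e / 3 by rewrite divr_gt0.
have [N hN] := filter_ex (bump_conv_unif hmu ch e3).
near=> n.
have := Lclose n _ _ _ (fun z => ltW (hN z)).
have : `|\int[mu]_z h z - L n (fun z => bump_conv mu h N z / kernel_coef N N)|
    < e / 3.
  by near: n; move/cvgrPdist_lt : (Lconv N); apply.
by rewrite !(ltr_norml, ler_norml); lra.
Unshelve. all: by end_near. Qed.

End kernel.
(** * Measurability of products of rotations *)

Section measurability.
Variable R : realType.

(** h o X is a pointwise limit of trigonometric polynomials in X. Together with
    the multiplicativity of characters this gives the measurability of
    continuous functions of a product of random rotations. *)
Lemma measurable_circle_comp d (T : measurableType d) (X : T -> circle R)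
    (h : circle R -> R) :
  (forall k, measurable_fun setT (fun w => char_re k (X w))) ->
  (forall k, measurable_fun setT (fun w => char_im k (X w))) ->
  continuous h -> measurable_fun setT (fun w => h (X w)).
Proof.
move=> mre mim ch; have [mu hmu] := @exists_haar R.
apply: (@measurable_fun_cvg _ _ _ _
  (fun N w => bump_conv mu h N (X w) / kernel_coef R N N)).
  move=> N; apply: measurable_funM => //.
  apply: measurable_sum => j; apply: measurable_funM => //.
  by apply: measurable_funD; apply: measurable_funM.
move=> w _; apply/cvgrPdist_lt => e e0.
by apply: filterS (bump_conv_unif hmu ch e0) => N; apply.
Qed.

Lemma measurable_circle_prod d (T : measurableType d)
    (X : nat -> T -> circle R) (m : nat) :
  (forall j, measurable_fun setT (X j)) ->
  (forall k, measurable_fun setT (fun w => char_re k (\prod_(1 <= j < m.+1) X j w)%g)) /\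
  (forall k, measurable_fun setT (fun w => char_im k (\prod_(1 <= j < m.+1) X j w)%g)).
Proof.
move=> mX.
have mre k j : measurable_fun setT (fun w => char_re k (X j w)).
  apply: (measurableT_comp _ (mX j)); apply: continuous_circle_measurable.
  exact: char_re_continuous.
have mim k j : measurable_fun setT (fun w => char_im k (X j w)).
  apply: (measurableT_comp _ (mX j)); apply: continuous_circle_measurable.
  exact: char_im_continuous.
elim: m => [|m [IHre IHim]].
  split=> k.
    rewrite (_ : (fun _ => _) = cst (char_re k 1%g)); first exact: measurable_cst.
    by apply/funext => w; rewrite big_geq.
  rewrite (_ : (fun _ => _) = cst (char_im k 1%g)); first exact: measurable_cst.
  by apply/funext => w; rewrite big_geq.
split=> k.
  rewrite (_ : (fun _ => _) = fun w =>
      char_re k (\prod_(1 <= j < m.+1) X j w)%g * char_re k (X m.+1 w) -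
      char_im k (\prod_(1 <= j < m.+1) X j w)%g * char_im k (X m.+1 w)).
    by apply: measurable_funB; exact: measurable_funM.
  by apply/funext => w; rewrite big_nat_recr//= char_reM.
rewrite (_ : (fun _ => _) = fun w =>
    char_re k (\prod_(1 <= j < m.+1) X j w)%g * char_im k (X m.+1 w) +
    char_im k (\prod_(1 <= j < m.+1) X j w)%g * char_re k (X m.+1 w)).
  by apply: measurable_funD; exact: measurable_funM.
by apply/funext => w; rewrite big_nat_recr//= char_imM.
Qed.

Lemma measurable_circle_set1 (u : circle R) : measurable [set u].
Proof.
have cb : continuous (fun z : circle R => bump (z * u^-1)%g).
  move=> z; apply: (@continuous_comp _ _ _ (fun z : circle R => (z * u^-1)%g) (@bump R)).
    exact: mulr_circle_continuous.
  exact: bump_continuous.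
rewrite (_ : [set u] = (fun z : circle R => bump (z * u^-1)%g) @^-1` [set 1]).
  by rewrite -[X in measurable X]setTI; exact: continuous_circle_measurable.
apply/seteqP; split => z /= => [->|/bump_eq1/(congr1 (fun x => x * u)%g)].
  by rewrite mulgV /bump /char_re expr1z /=; lra.
by rewrite mulgVK mul1g.
Qed.

End measurability.

(** * The law of the random walk *)

Section walk.
Variable R : realType.
Variables (p : nat -> R) (a b : circle R).

(** The expectation of h after n independent steps, the j-th step being a with
    probability p j and b otherwise. The recursion conditions on the last step,
    and involves h only through finitely many of its values. *)
Fixpoint walk_mean n (h : circle R -> R) : R :=
  if n is m.+1 then p n * walk_mean m (fun z => h (z * a)%g) +
                    (1 - p n) * walk_mean m (fun z => h (z * b)%g)
  else h 1%g.

Lemma walk_meanP n c f g :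
  walk_mean n (fun z => c * f z + g z) = c * walk_mean n f + walk_mean n g.
Proof.
elim: n f g => [//|n IH] f g /=.
rewrite (IH (fun z => f (z * a)%g) (fun z => g (z * a)%g)).
by rewrite (IH (fun z => f (z * b)%g) (fun z => g (z * b)%g)); ring.
Qed.

Lemma walk_mean1 n : walk_mean n (cst 1) = 1.
Proof.
elim: n => [//|n IH] /=; rewrite -[fun=> _]/(cst 1) !IH; ring.
Qed.

Lemma le_walk_mean n f g : (forall j, 0 <= p j <= 1) ->
  (forall z, f z <= g z) -> walk_mean n f <= walk_mean n g.
Proof.
move=> p01; elim: n f g => [|n IH] f g fg /=; first exact: fg.
have /andP[p0 p1] := p01 n.+1.
by apply: lerD; apply: ler_wpM2l; rewrite ?subr_ge0//; exact: IH.
Qed.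

End walk.

Section walk_law.
Variable R : realType.
Variables (p : nat -> R) (a b : circle R).
Hypothesis ab : a != b.
Variables (d : measure_display) (Omega : measurableType d)
  (P : probability Omega R) (rot : nat -> {RV P >-> circle R}).
Hypothesis indep : mutually_independent P [set j | (1 <= j)%N]
  (fun j => rot j : Omega -> circle R).
Hypothesis rota : forall j, (1 <= j)%N -> P (rot j @^-1` [set a]) = (p j)%:E.
Hypothesis rotb : forall j, (1 <= j)%N -> P (rot j @^-1` [set b]) = (1 - p j)%:E.

Local Notation X m w := (\prod_(1 <= j < m.+1) rot j w)%g.
Local Notation cyl J A := (\bigcap_(j in [set` J]) (rot j @^-1` A j)).

Let X_integrable m (h : circle R -> R) D : measurable D -> continuous h ->
  P.-integrable D (EFin \o (fun w => h (X m w))).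
Proof.
move=> mD ch; apply: (@integrableS _ _ _ _ setT) => //.
have [mre mim] := @measurable_circle_prod _ _ _ (fun j => rot j) m
  (fun j => measurable_funP (rot j)).
apply: measurable_bounded_integrable => //.
- exact: le_lt_trans (probability_le1 P measurableT) (ltry 1).
- exact: (measurable_circle_comp mre mim ch).
have [M M0 hM] := circle_continuous_bounded ch.
exists M; split; first by rewrite num_real.
by move=> x Mx w _ /=; exact: le_trans (hM _) (ltW Mx).
Qed.

Let cyl_measurable (J : {fset nat}) (A : nat -> set (circle R)) :
  (forall j, measurable (A j)) -> measurable (cyl J A).
Proof.
by move=> mA; apply: bigcap_measurableType => j _; exact: measurable_funPTI.
Qed.

(** Carrying an event that depends on later steps only is what makes the
    induction work: to peel off step m + 1, the event that this step is a
    (or b) is intersected with the given one, and on the result the last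
    factor of the product is constant. *)
Lemma walk_lawP m (J : {fset nat}) (A : nat -> set (circle R)) (h : circle R -> R) :
  continuous h -> (forall j, measurable (A j)) ->
  (forall j, j \in J -> (m < j)%N) ->
  \int[P]_(w in cyl J A) h (X m w) = fine (P (cyl J A)) * walk_mean p a b m h.
Proof.
elim: m J A h => [|m IH] J A h ch mA mJ.
  transitivity (\int[P]_(w in cyl J A) h 1%g).
    by apply: eq_Rintegral => w _; rewrite big_geq.
  by rewrite mulrC; exact: Rintegral_cst (cyl_measurable J mA) _.
have m1J : m.+1 \notin J by apply/negP => /mJ; rewrite ltnn.
set C := cyl J A; have mC : measurable C by exact: cyl_measurable.
pose A' B j := if j == m.+1 then B else A j.
have mA' B : measurable B -> forall j, measurable (A' B j).
  by move=> mB j; rewrite /A'; case: ifP.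
have A'J B j : j \in J -> A' B j = A j.
  by rewrite /A'; case: eqP => // -> j1; rewrite j1 in m1J.
have cylE B : cyl (m.+1 |` J)%fset (A' B) = rot m.+1 @^-1` B `&` C.
  rewrite bigcap_fsetU1; congr (_ `&` _); first by rewrite /A' eqxx.
  by apply: eq_bigcapr => j /= jJ; rewrite A'J.
have mJ' j : j \in (m.+1 |` J)%fset -> (m < j)%N.
  by rewrite !inE => /orP[/eqP ->//|/mJ /ltnW].
have PC B : measurable B ->
    P (rot m.+1 @^-1` B `&` C) = (P (rot m.+1 @^-1` B) * P C)%E.
  move=> mB; rewrite -cylE indep//; last 2 first.
  - by move=> j /= /mJ'; exact: leq_ltn_trans.
  - exact: mA'.
  rewrite big_fsetU1//= {1}/A' eqxx; congr (_ * _)%E.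
  rewrite /C indep//; last by move=> j /= /mJ; exact: leq_ltn_trans.
  by apply: eq_big_seq => j jJ; rewrite A'J.
have hit B c : measurable B -> B `<=` [set c] -> 
    \int[P]_(w in rot m.+1 @^-1` B `&` C) h (X m.+1 w) =
    fine (P (rot m.+1 @^-1` B)) * fine (P C) *
      walk_mean p a b m (fun z : circle R => h (z * c)%g).
  move=> mB Bc; rewrite -fineM ?fin_num_measure//; last exact: measurable_funPTI.
  have chc : continuous (fun z : circle R => h (z * c)%g).
    move=> z.
    apply: (@continuous_comp _ _ _ (fun z : circle R => (z * c)%g) h); last exact: ch.
    exact: mulr_circle_continuous.
  rewrite -PC// -cylE -(IH _ _ _ chc (mA' B mB) mJ').
  rewrite cylE; apply: eq_Rintegral => w; rewrite inE => -[/= /Bc rc _].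
  by rewrite big_nat_recr//= rc.
set Ba := rot m.+1 @^-1` [set a]; set Bb := rot m.+1 @^-1` [set b].
have ma : measurable Ba by apply: measurable_funPTI; exact: measurable_circle_set1.
have mb : measurable Bb by apply: measurable_funPTI; exact: measurable_circle_set1.
have dab : [disjoint Ba & Bb].
  by apply/disj_setPS => w [/= wa wb]; move: ab; rewrite -wa -wb eqxx.
have dab0 : Ba `&` Bb = set0 by exact/eqP.
have mab : measurable (Ba `|` Bb) by exact: measurableU.
have Pab : P (~` (Ba `|` Bb)) = 0%E.
  have E : P (Ba `|` Bb) = 1%E.
    transitivity (P Ba + P Bb)%E; first exact: measureU.
    rewrite /Ba /Bb rota// rotb// -EFinD.
    by congr EFin; ring.
  by rewrite probability_setC// E subee.
(* The two prescribed values have total probability 1, so what remains of C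
   is negligible. *)
set N := ~` (Ba `|` Bb) `&` C.
have mN : measurable N by apply: measurableI => //; exact: measurableC.
have PN : P N = 0%E.
  apply/eqP; rewrite eq_le measure_ge0 andbT -Pab le_measure ?inE//.
    exact: measurableC.
  exact: subIsetl.
have CE : C = (Ba `|` Bb) `&` C `|` N by rewrite /N -setIUl setUv setTI.
rewrite {1}CE Rintegral_setU//; last 3 first.
- exact: measurableI.
- by apply: X_integrable => //; rewrite -CE.
- by apply/disj_setPS => w [/= [? _] [? _]].
have -> : \int[P]_(w in N) h (X m.+1 w) = 0.
  rewrite /Rintegral null_set_integral//.
  by case/integrableP : (@X_integrable m.+1 h _ mN ch).
rewrite addr0 setIUl Rintegral_setU//; last 4 first.
- exact: measurableI.
- exact: measurableI.
- by apply: X_integrable => //; apply: measurableU; exact: measurableI.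
- apply/disj_setPS => w [/= [wa _] [wb _]].
  by have : (Ba `&` Bb) w by []; rewrite dab0.
rewrite /Ba /Bb (hit _ a)//; last exact: measurable_circle_set1.
rewrite (hit _ b)//; last exact: measurable_circle_set1.
by rewrite rota// rotb//=; ring.
Qed.

Lemma walk_law m (h : circle R -> R) : continuous h ->
  (\int[P]_w (h (\prod_(1 <= j < m.+1) rot j w)%g)%:E)%E = (walk_mean p a b m h)%:E.
Proof.
move=> ch; have := @walk_lawP m fset0 (fun=> setT) h ch (fun=> measurableT).
rewrite set_fset0 bigcap_set0 probability_setT mul1r => <-//.
rewrite /Rintegral fineK//; apply: integrable_fin_num => //.
exact: (@X_integrable m h _ measurableT ch).
Qed.

End walk_law.
(** * Decay of the Fourier coefficients *)

Section walk_chars.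
Variable R : realType.
Variables (p : nat -> R) (a : circle R).
Hypothesis p01 : forall j, 0 <= p j <= 1.
Local Notation L := (walk_mean p a a^-1%g).

Lemma walk_meanD n c1 c2 f1 f2 :
  L n (fun z => c1 * f1 z + c2 * f2 z) = c1 * L n f1 + c2 * L n f2.
Proof.
rewrite (walk_meanP p a a^-1%g n c1 f1 (fun z => c2 * f2 z)); congr (_ + _).
have L0 : L n (cst 0) = 0.
  have := walk_meanP p a a^-1%g n (-1) (cst 0) (cst 0).
  rewrite (_ : (fun _ => _) = cst 0); last by apply/funext => z /=; ring.
  by move=> E; lra.
rewrite (_ : (fun _ => _) = fun z => c2 * f2 z + cst 0 z).
  by rewrite walk_meanP L0 addr0.
by apply/funext => z /=; rewrite addr0.
Qed.

Definition walk_char_sq (k : int) n :=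
  L n (char_re k) ^+ 2 + L n (char_im k) ^+ 2.

(** The Fourier coefficient of index k is multiplied at step n + 1 by
    p a^k + (1 - p) a^(-k), whose squared modulus is
    (Re a^k)^2 + (2 p - 1)^2 (Im a^k)^2. *)
Lemma walk_char_sqS k n :
  walk_char_sq k n.+1 = walk_char_sq k n *
    (1 - 4 * (p n.+1 * (1 - p n.+1)) * char_im k a ^+ 2).
Proof.
have reM u : L n (fun z => char_re k (z * u)%g) =
    char_re k u * L n (char_re k) + (- char_im k u) * L n (char_im k).
  by rewrite -walk_meanD; congr (L n); apply/funext => z; rewrite char_reM; ring.
have imM u : L n (fun z => char_im k (z * u)%g) =
    char_im k u * L n (char_re k) + char_re k u * L n (char_im k).
  by rewrite -walk_meanD; congr (L n); apply/funext => z; rewrite char_imM; ring.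
rewrite /walk_char_sq /= !reM !imM !char_reV !char_imV.
have := char_norm k a.
move: (char_re k a) (char_im k a) (p n.+1) (L n _) (L n _) => x y q C S xy.
transitivity ((C ^+ 2 + S ^+ 2) *
    (x ^+ 2 + y ^+ 2 - 4 * (q * (1 - q)) * y ^+ 2)); last by rewrite xy addrC.
by ring.
Qed.

(** An inductive form of the bound of a product of factors 1 - t_j by
    1 / (1 + T), T being the sum of the t_j: it follows from
    (1 - t) (1 + T + t) <= 1 + T for t, T >= 0. *)
Lemma walk_char_sq_le k n :
  walk_char_sq k n *
    (1 + 4 * char_im k a ^+ 2 * \sum_(1 <= j < n.+1) p j * (1 - p j)) <= 1.
Proof.
have N0 m : 0 <= walk_char_sq k m by rewrite addr_ge0// sqr_ge0.
have y0 : 0 <= char_im k a ^+ 2 := sqr_ge0 _.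
elim: n => [|n IH].
  by rewrite big_geq// mulr0 addr0 mulr1 /walk_char_sq /= char_norm.
have q0 : 0 <= p n.+1 * (1 - p n.+1).
  by have /andP[p0 p1] := p01 n.+1; rewrite mulr_ge0// subr_ge0.
have T0 : 0 <= \sum_(1 <= j < n.+1) p j * (1 - p j).
  by apply: sumr_ge0 => j _; have /andP[p0 p1] := p01 j; rewrite mulr_ge0// subr_ge0.
rewrite walk_char_sqS big_nat_recr//=; apply: le_trans IH.
move: (walk_char_sq k n) (N0 n) (char_im k a ^+ 2) y0 (p n.+1 * _) q0
  (\sum_(_ <= _ < _) _) T0.
move=> M M0 y y0 q q0 T T0; rewrite -mulrA ler_wpM2l//.
have : 0 <= (4 * q * y) * (4 * y * (T + q)) by rewrite !mulr_ge0// addr_ge0.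
lra.
Qed.

Lemma walk_char_cvg k : char_im k a != 0 ->
  \sum_(1 <= j < n.+1) p j * (1 - p j) @[n --> \oo] --> +oo ->
  L n (char_re k) @[n --> \oo] --> (0 : R) /\
  L n (char_im k) @[n --> \oo] --> (0 : R).
Proof.
move=> y0 Soo.
have N_small (e : R) : 0 < e -> \forall n \near \oo, walk_char_sq k n < e ^+ 2.
  move=> e0; have y2 : 0 < 4 * char_im k a ^+ 2.
    by rewrite mulr_gt0// lt_neqAle eq_sym sqrf_eq0 y0 sqr_ge0.
  have e2 : 0 < e ^+ 2 by rewrite exprn_gt0.
  move/cvgryPge : Soo => /(_ (e ^- 2 / (4 * char_im k a ^+ 2))).
  apply: filterS => n; rewrite ler_pdivrMr// mulrC => Sn.
  have := walk_char_sq_le k n.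
  have N0 : 0 <= walk_char_sq k n by rewrite addr_ge0// sqr_ge0.
  move: (walk_char_sq k n) N0 (4 * char_im k a ^+ 2 * _) Sn => M M0 T eT MT.
  rewrite -[M]mulr1 -(mulVf (lt0r_neq0 e2)) mulrA -[ltRHS]mul1r ltr_pM2r//.
  have [M00|Mpos] := eqVneq M 0; first by rewrite M00 mul0r.
  have {}M0 : 0 < M by rewrite lt_neqAle eq_sym Mpos.
  apply: lt_le_trans MT; rewrite ltr_pM2l//.
  by apply: le_lt_trans eT _; rewrite ltrDr.
split; apply/cvgrPdist_lt => e e0; apply: filterS (N_small e e0) => n Ne.
  rewrite sub0r normrN -(@ltr_pXn2r _ 2) ?nnegrE ?(ltW e0)// real_normK ?num_real//.
  by apply: le_lt_trans Ne; rewrite lerDl sqr_ge0.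
rewrite sub0r normrN -(@ltr_pXn2r _ 2) ?nnegrE ?(ltW e0)// real_normK ?num_real//.
by apply: le_lt_trans Ne; rewrite lerDr sqr_ge0.
Qed.

End walk_chars.

(** * Irrational rotations *)

Section irrational_angle.
Variable R : realType.

Lemma turnD (s t : R) : turn (s + t) = (turn s * turn t)%g.
Proof. by rewrite /turn mulrDr cisD. Qed.

Lemma turn0 : turn (0 : R) = 1%g.
Proof. by apply/val_inj/eqP; rewrite eq_complex /= mulr0 cos0 sin0 !eqxx. Qed.

Lemma turn_int (m : int) : turn (m%:~R : R) = 1%g.
Proof.
apply: bump_eq1; rewrite /bump char_re_turn mulr1.
have := char_re_turn m (1 : R).
rewrite (_ : turn 1 = 1%g) => [|]; last by rewrite -[X in turn X]add0r turnD1 turn0.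
by rewrite mulr1 /char_re exp1rz => <- /=; lra.
Qed.

(** For the fractional part s of t, cos (2 pi s) = 1 gives sin (pi s) = 0, and
    sin is positive on the open interval from 0 to pi. *)
Lemma turn_eq1 (t : R) : turn t = 1%g -> t = (Num.floor t)%:~R.
Proof.
move=> t1; set m := Num.floor t; set s := t - m%:~R.
have s0 : 0 <= s by rewrite subr_ge0 floor_le.
have s1 : s < 1 by rewrite ltrBlDl -[1]/(1%:~R) -intrD floorD1_gt.
have ts : turn s = 1%g.
  by rewrite -[LHS]mulg1 -(turn_int m) -turnD subrK t1 turn_int.
have c1 : cos (2 * pi * s) = 1.
  have := char_re_turn 1 s; rewrite ts mulr1 => <-.
  by rewrite /char_re expr1z.
have : cos (pi * s + pi * s) = 1 by rewrite -c1; congr cos; ring.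
rewrite cosD -!expr2 => E.
have := cos2Dsin2 (pi * s) => E'.
have /eqP : sin (pi * s) ^+ 2 = 0 by lra.
rewrite sqrf_eq0 => /eqP sin0.
apply/eqP; rewrite -subr_eq0 -/s; apply/eqP.
have [//|sn0] := eqVneq s 0.
have sp : 0 < s by rewrite lt_neqAle eq_sym sn0.
have : 0 < sin (pi * s).
  by apply: sin_gt0_pi; rewrite mulr_gt0 ?pi_gt0//= gtr_pMr ?pi_gt0.
by rewrite sin0 ltxx.
Qed.

(** If sin (2 pi theta k) = 0 then the double angle is a whole number of turns,
    so 2 theta k is an integer. *)
Lemma irrational_char_im (theta : R) (k : int) : irrational theta -> k != 0 ->
  char_im k (turn theta) != 0.
Proof.
move=> irr k0; apply/negP; rewrite char_im_turn => /eqP sin0.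
apply: irr; have k0R : k%:~R != 0 :> R by rewrite intr_eq0.
have : turn (2 * theta * k%:~R) = 1%g.
  apply: bump_eq1; rewrite /bump char_re_turn mulr1.
  set x := 2 * pi * theta * k%:~R in sin0.
  have -> : 2 * pi * (2 * theta * k%:~R) = x + x by rewrite /x; ring.
  have := cos2Dsin2 x; rewrite cosD sin0 expr0n /= addr0 -expr2 => ->.
  by rewrite mulr0; lra.
move=> /turn_eq1 E; exists ((Num.floor (2 * theta * k%:~R))%:~R / (2 * k%:~R)) => //.
rewrite rmorphM fmorphV rmorphM /= !ratr_int ratr_nat -E.
by field.
Qed.

End irrational_angle.

(** * Divergence of the sum of the variances *)

Section divergence.
Variables (R : realType) (d : measure_display) (E : measurableType d).
Variables (rho : probability E R) (tau : E -> E).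

(** With c the integral of g, the sums exceed n c - (c / 2) sqrt n >= n c / 2
    eventually. *)
Lemma C2_sum_pinfty (g : E -> R) (x : E) :
  C2 rho tau g -> 0 < \int[rho]_y g y ->
  \sum_(1 <= i < n.+1) g (iter i tau x) @[n --> \oo] --> +oo.
Proof.
move=> [_ C2g]; set c := \int[rho]_y g y => c0.
have c2 : 0 < c / 2 by rewrite divr_gt0.
apply/cvgryPge => A; near=> n.
have sup_n : (ereal_sup [set `| \sum_(1 <= i < n.+1)
    (g (iter i tau x) - c) |%:E | x in setT] <= (c / 2 * Num.sqrt n%:R)%:E)%E.
  by near: n; exact: C2g.
have : `|\sum_(1 <= i < n.+1) (g (iter i tau x) - c)| <= c / 2 * Num.sqrt n%:R.
  rewrite -lee_fin; apply: le_trans sup_n; apply: ereal_sup_ubound.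
  by exists x.
rewrite sumrB sumr_const_nat subSS subn0 ler_norml => /andP[+ _].
have sqrt_le : Num.sqrt n%:R <= n%:R :> R.
  rewrite -[leRHS]ger0_norm// -sqrtr_sqr ler_wsqrtr// -natrX ler_nat.
  by rewrite -mulnn; case: (n) => // m; rewrite leq_pmulr.
have An : A / (c / 2) <= n%:R by near: n; exact: nbhs_infty_ger.
rewrite ler_pdivrMr// in An.
rewrite -[c *+ n]mulr_natr => H.
have := ler_wpM2l (ltW c2) sqrt_le.
lra.
Unshelve. all: by end_near. Qed.

(** If the integral vanished then f (1 - f) would vanish almost everywhere, and f
    would be the indicator function of the set where it equals 1. *)
Lemma not_indicator_integral_gt0 (f : E -> R) : measurable_fun setT f ->
  (forall x, 0 <= f x <= 1) ->
  rho.-integrable setT (EFin \o (fun x => f x * (1 - f x))) ->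
  ~ (exists A : set E, {ae rho, forall x, f x = \1_A x}) ->
  0 < \int[rho]_x (f x * (1 - f x)).
Proof.
move=> mf f01 gint nind.
have g0 x : 0 <= f x * (1 - f x).
  by have /andP[f0 f1] := f01 x; rewrite mulr_ge0// subr_ge0.
rewrite lt_neqAle Rintegral_ge0// andbT eq_sym; apply/negP => /eqP I0.
apply: nind; exists (f @^-1` [set 1]).
have : (\int[rho]_x `|(f x * (1 - f x))%:E| = 0)%E.
  under eq_integral do rewrite gee0_abs ?lee_fin//.
  by rewrite -[LHS]fineK ?integrable_fin_num// -/(Rintegral _ _ _) I0.
case/integrableP : gint => mg _.
move/(ae_eq_integral_abs rho measurableT mg).
apply: filterS => x /= /(_ I) [] /eqP.
rewrite mulf_eq0 subr_eq0 => /orP[/eqP fx|/eqP fx].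
  by rewrite fx indicE memNset//= fx => /eqP; rewrite eq_sym oner_eq0.
by rewrite -fx indicE mem_set.
Qed.

End divergence.

Theorem theorem3p3 (R : realType) (d : measure_display)
    (E : measurableType d) (rho : probability E R) (tau : E -> E)
    (theta : R) (f : E -> R) (haar : probability (circle R) R) :
  measurable_fun setT tau ->
  irrational theta ->
  measurable_fun setT f ->
  (forall x, 0 <= f x <= 1) ->
  C2 rho tau (fun x => f x * (1 - f x)) ->
  ~ (exists A : set E, {ae rho, forall x, f x = \1_A x}) ->
  is_haar haar ->
  {ae rho, forall x,
    forall (d' : measure_display) (Omega : measurableType d')
      (P : probability Omega R) (rot : nat -> {RV P >-> circle R}),
    mutually_independent P [set j | (1 <= j)%N]
      (fun j => rot j : Omega -> circle R) ->
    (forall j, (1 <= j)%N ->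
      P (rot j @^-1` [set cis (2 * pi * theta)]) = (f (iter j tau x))%:E /\
      P (rot j @^-1` [set cis (- (2 * pi * theta))])
        = (1 - f (iter j tau x))%:E) ->
    converges_in_law P
      (fun n w => (\prod_(1 <= j < n.+1) rot j w)%g) haar}.
Proof.
move=> _ irr mf f01 C2g nind hhaar.
apply: aeW => x d' Omega P rot indep rotP h ch _.
have c0 := not_indicator_integral_gt0 mf f01 C2g.1 nind.
have Soo := C2_sum_pinfty x C2g c0.
have -> : (\int[haar]_z (h z)%:E)%E = (\int[haar]_z h z)%:E.
  rewrite /Rintegral fineK//; apply: integrable_fin_num => //.
  exact: circle_continuous_integrable.
set a := turn theta; pose p j := f (iter j tau x).
have aV : cis (- (2 * pi * theta)) = a^-1%g.
  rewrite -[LHS](mulgK a) -[RHS]mul1g; congr (_ * _)%g.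
  by rewrite /a /turn -cisD addNr -[RHS]turn0 /turn mulr0.
(* The two steps are distinct, since Im a <> 0. *)
have aaV : a != a^-1%g.
  apply/eqP => aE; have /eqP := irrational_char_im irr (isT : (1 : int) != 0).
  by apply; have := char_imV 1 a; rewrite -aE -/a => ?; lra.
have law n : (\int[P]_w (h (\prod_(1 <= j < n.+1) rot j w)%g)%:E)%E =
    (walk_mean p a a^-1%g n h)%:E.
  apply: (walk_law aaV indep) => //.
    by move=> j /rotP[-> _].
  by move=> j j1; rewrite -aV; have [_ ->] := rotP j j1.
under eq_fun do rewrite law.
apply: cvg_EFin; first exact: nearW.
have dec k : k != 0 -> _ := fun k0 =>
  walk_char_cvg (fun j => f01 (iter j tau x)) (irrational_char_im irr k0) Soo.
apply: (weyl_criterion hhaar) => //.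
- by move=> *; exact: walk_meanP.
- by move=> n f1 f2 f12; apply: le_walk_mean => // j; exact: f01.
- exact: walk_mean1.
- by move=> k /dec[].
- by move=> k /dec[].
Qed.
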